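(* Any $k\in\mathbb{Z}$ is the determinant of a renewal system of finite type with cyclic Bowen-Franks group.
   Context: For a finite list $L$ of nonempty words over a finite alphabet, the renewal system $\mathsf{X}(L)$ is the (two-sided) shift space whose language is the set of factors of finite concatenations of words from $L$. A shift of finite type (SFT) is a shift space defined by a finite set of forbidden words. Every SFT is conjugate to the edge shift of a finite directed graph with some adjacency matrix $A$ (an $n\times n$ matrix of non-negative integers). The determinant of the SFT is $\det(\mathrm{Id}-A)$ and its Bowen-Franks group is $\mathbb{Z}^n/\mathbb{Z}^n(\mathrm{Id}-A)$; these do not depend on the choice of $A$. *)

(* Defs.v *)
From HB Require Import structures.
From mathcomp Require Import all_boot all_order all_algebra.
From mathcomp Require Import generic_quotient ring_quotient.
From mathcomp Require Import boolp classical_sets.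

Set Implicit Arguments.
Unset Strict Implicit.
Unset Printing Implicit Defensive.

Import GRing.Theory.

Local Open Scope classical_set_scope.
Local Open Scope ring_scope.

Section Shifts.
Variable A : finType.
Implicit Types (x : int -> A) (w : seq A) (L F : seq (seq A)).

(* The word x_i x_(i+1) ... x_(i+n-1). *)
Definition block x (i : int) (n : nat) : seq A :=
  mkseq (fun j => x (i + j%:Z)) n.

Definition occurs w x := exists i : int, block x i (size w) = w.

Definition language (X : set (int -> A)) : set (seq A) :=
  [set w | exists2 x, X x & occurs w x].

Definition avoiding F : set (int -> A) :=
  [set x | forall w, w \in F -> ~ occurs w x].

Definition finite_type (X : set (int -> A)) : Prop :=
  exists F : seq (seq A), X = avoiding F.

Definition renewal_language L : set (seq A) :=
  [set w | exists2 s : seq (seq A), {subset s <= L} & infix w (flatten s)].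

(* A shift space is determined by its language, as the set of all points whose
   finite blocks lie in it; language_renewal_shift below checks that the
   language of the following shift space is indeed renewal_language L. *)
Definition renewal_shift L : set (int -> A) :=
  [set x | forall i n, renewal_language L (block x i n)].

End Shifts.

Section Conjugacy.
Variables (A B : finType) (X : set (int -> A)) (Y : set (int -> B)).

(* Only the values of the block map on blocks occurring in X matter; it takes
   values in option B so that it also exists when X and B are both empty. *)
Definition sliding_block_code (f : X -> Y) : Prop :=
  exists (m n : nat) (Phi : (m + n).+1.-tuple A -> option B),
    forall (x : X) (i : int) (u : (m + n).+1.-tuple A),
      block (val x) (i - m%:Z) (m + n).+1 = u -> Phi u = Some (val (f x) i).

End Conjugacy.

Definition conjugate (A B : finType) (X : set (int -> A)) (Y : set (int -> B)) :=
  exists (f : X -> Y) (g : Y -> X),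
    [/\ sliding_block_code f, sliding_block_code g, cancel f g & cancel g f].

Section Matrices.
Variables (n : nat) (M : 'M[nat]_n).

(* An edge from i to j is a pair (i, j) together with one of M i j labels. *)
Definition edge : finType := {ij : 'I_n * 'I_n & 'I_(M ij.1 ij.2)}.
Definition source (e : edge) : 'I_n := (tag e).1.
Definition target (e : edge) : 'I_n := (tag e).2.

Definition edge_shift : set (int -> edge) :=
  [set x | forall i : int, target (x i) = source (x (i + 1))].

Definition id_minus : 'M[int]_n := 1%:M - map_mx Posz M.

End Matrices.

Arguments edge_shift {n} M _.

Section RowLattice.
Variables (n : nat) (B : 'M[int]_n).

Definition row_lattice : pred 'rV[int]_n :=
  fun v => `[< exists u : 'rV[int]_n, v = u *m B >].

Fact row_lattice_zmod_closed : zmod_closed row_lattice.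
Proof.
split=> [|u v /asboolP[u' ->] /asboolP[v' ->]]; apply/asboolP.
  by exists 0; rewrite mul0mx.
by exists (u' - v'); rewrite mulmxBl.
Qed.

HB.instance Definition _ :=
  GRing.isZmodClosed.Build 'rV[int]_n row_lattice row_lattice_zmod_closed.

End RowLattice.

Definition bowen_franks n (M : 'M[nat]_n) : zmodType :=
  Quotient.quot (GRing.ZmodClosed.clone _ (row_lattice (id_minus M)) _).

Definition cyclic_zmod (V : zmodType) : Prop :=
  exists g : V, forall x : V, exists k : int, x = g *~ k.

Lemma language_renewal_shift (A : finType) (L : seq (seq A)) :
  L != [::] -> [::] \notin L ->
  language (renewal_shift L) = renewal_language L.
Proof.
move=> L0 Lne; apply/seteqP; split=> w.
  by move=> [x Xx [i <-]]; apply: Xx.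
move=> [s sL ws].
have [l lL] : exists l, l \in L.
  by case: L L0 {Lne sL} => // l L _; exists l; rewrite mem_head.
pose t := flatten (l :: s).
have wt : infix w t by rewrite /t /=; apply: infix_catl.
have t0 : (0 < size t)%N.
  by rewrite /t /= size_cat ltn_addr // lt0n size_eq0; apply: contraNneq Lne => <-.
have [a _] : exists a, a \in t.
  by case: t t0 {wt} => // a t' _; exists a; rewrite mem_head.
pose N := size t.
pose x (i : int) := nth a t `|(i %% N)%Z|%N.
have modn_mod (k : nat) : `|(k%:Z %% N)%Z|%N = (k %% N)%N.
  by rewrite modz_nat absz_nat.
have nth_pow p k : (k < p * N)%N ->
    nth a (flatten (nseq p t)) k = nth a t (k %% N).
  elim: p k => [|p IH] k; first by rewrite mul0n.
  rewrite mulSn /= nth_cat -/N => kp.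
  case: ltnP => kN; first by rewrite modn_small.
  by rewrite IH ?ltn_subLR // -[in RHS](subnK kN) modnDr.
have size_pow p : size (flatten (nseq p t)) = (p * N)%N.
  by elim: p => // p IH; rewrite /= size_cat IH mulSn.
have blockE i n : exists p,
    block x i n = take n (drop `|(i %% N)%Z|%N (flatten (nseq p t))).
  set r := `|(i %% N)%Z|%N; have N0 : N%:Z != 0 by rewrite -lt0n.
  have rE : r%:Z = (i %% N)%Z by rewrite /r gez0_abs // modz_ge0.
  have len : (r + n <= (r + n) * N)%N by rewrite leq_pmulr.
  exists (r + n)%N; apply: (@eq_from_nth _ a) => [|j].
    rewrite size_mkseq size_takel // size_drop size_pow leq_subRL ?leq_subr //.
    exact: leq_trans (leq_addr _ _) len.
  rewrite size_mkseq => jn; rewrite nth_mkseq // nth_take // nth_drop nth_pow.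
    by rewrite /x -modzDml -rE -PoszD modn_mod.
  by apply: leq_trans len; rewrite ltn_add2l.
exists x.
  move=> i n; have [p ->] := blockE i n.
  exists (flatten (nseq p (l :: s))).
    move=> u /flattenP[v /nseqP[-> _]]; rewrite inE => /predU1P[-> //|].
    exact: sL.
  have -> : flatten (flatten (nseq p (l :: s))) = flatten (nseq p t).
    by elim: p => // p IH; rewrite /= flatten_cat IH catA.
  apply/infixP; set T := flatten _; set r := `|_|%N.
  by exists (take r T), (drop n (drop r T)); rewrite !cat_take_drop.
have /infixP[b [c tE]] := wt.
exists (size b)%:Z.
apply: (@eq_from_nth _ a) => [|j]; rewrite size_mkseq // => jw.
have jN : (size b + j < N)%N.
  by rewrite /N tE !size_cat ltn_add2l ltn_addr.
rewrite nth_mkseq // /x -PoszD modn_mod modn_small // tE.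
by rewrite !nth_cat -ltn_subRL subnn ltn0 addKn jw.
Qed.

(* Main.v *)
(* Take three letters a, two letters b, c letters of a third kind C and d of a
   fourth kind D, and let the words be all a, b and D, together with all aC and
   Cb. Each C may use the a on its left or the b on its right, and no a or b is
   ever claimed twice, so that the only constraint is local: a C must be
   preceded by an a or followed by a b. The resulting shift of finite type is
   read off a deterministic graph with three states, with determinant
   c - d - 4. *)
Require Import Defs.
From mathcomp Require Import all_boot all_order all_algebra.
From mathcomp Require Import generic_quotient ring_quotient.
From mathcomp Require Import boolp classical_sets.
From mathcomp Require Import zify ring.

Set Implicit Arguments.
Unset Strict Implicit.
Unset Printing Implicit Defensive.

Import Order.TTheory GRing.Theory Num.Theory.

Local Open Scope ring_scope.

(** * Block maps given by a window *)

(** Lets a block map be specified by a relation instead of a formula: as [P] is functional, whatever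
    [pick] returns is the right letter. *)
Lemma sliding_block_code_of_window (A B : finType) (X : set (int -> A))
    (Y : set (int -> B)) (f : X -> Y) (m n : nat) (P : seq A -> pred B) :
  (forall w b b', P w b -> P w b' -> b = b') ->
  (forall (x : X) i, P (block (val x) (i - m%:Z) (m + n).+1) (val (f x) i)) ->
  sliding_block_code f.
Proof.
move=> Pinj Pf; exists m, n, (fun u => [pick b | P u b]) => x i u xu.
have := Pf x i; rewrite xu; case: pickP => [b Pb /(Pinj _ _ _ Pb) -> //|P0].
by rewrite P0.
Qed.

Lemma blockS (A : finType) (x : int -> A) i n :
  block x i n.+1 = x i :: block x (i + 1) n.
Proof.
rewrite /block /mkseq /= addr0 (iotaDl 1 0) -map_comp; congr cons.
by apply: eq_map => k /=; congr x; lia.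
Qed.

Lemma block3 (A : finType) (x : int -> A) i :
  block x i 3 = [:: x i; x (i + 1); x (i + 2)].
Proof. by rewrite !blockS -addrA. Qed.

(** * Edge shifts of deterministic labelled graphs *)

Section LabelledGraph.
Variables (A : finType) (n : nat) (delta : 'I_n -> A -> option 'I_n).

Definition graph_matrix : 'M[nat]_n :=
  \matrix_(i, j) #|[pred a | delta i a == Some j]|.

(** The number carried by an edge is decoded as a position in the enumeration of the letters leading
    from its source to its target. *)
Definition label (e : edge graph_matrix) : A :=
  enum_val (cast_ord (mxE _ _ (tag e).1 (tag e).2) (tagged e)).

Lemma delta_label (e : edge graph_matrix) :
  delta (source e) (label e) = Some (target e).
Proof. exact/eqP/(enum_valP (cast_ord (mxE _ _ _ _) (tagged e))). Qed.

Lemma edge_ex i a j : delta i a = Some j ->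
  exists2 e : edge graph_matrix, source e = i & label e = a.
Proof.
move=> /eqP da; have Ha : a \in [pred a | delta i a == Some j] by [].
exists (Tagged (fun ij => 'I_(graph_matrix ij.1 ij.2)) (i := (i, j))
  (cast_ord (esym (mxE _ _ i j)) (enum_rank_in Ha a))) => //.
by rewrite /label /= cast_ord_comp cast_ord_id enum_rankK_in.
Qed.

(** By determinism the target follows from source and label; the decoding of labels is then
    injective. *)
Lemma edge_inj (e e' : edge graph_matrix) :
  source e = source e' -> label e = label e' -> e = e'.
Proof.
move=> se le; have := delta_label e; rewrite se le delta_label => -[te].
move: e e' se le te => [[i j] u] [[i' j'] u']; rewrite /source /target /=.
move=> ? + ?; subst i' j'; rewrite /label /= => /enum_val_inj /cast_ord_inj -> //.
Qed.

Variables (st : A -> A -> 'I_n) (X : set (int -> A)).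

(** [st u v] stands for the state reached after reading [u] and then [v]; by [stP] two letters
    suffice to forget the starting state. *)
Hypothesis XP : forall x, X x <->
  forall i, delta (st (x i) (x (i + 1))) (x (i + 2)) =
            Some (st (x (i + 1)) (x (i + 2))).
Hypothesis stP : forall i u j v k,
  delta i u = Some j -> delta j v = Some k -> k = st u v.

Lemma source_st (e : int -> edge graph_matrix) (i : int) :
  edge_shift graph_matrix e ->
  source (e i) = st (label (e (i - 2))) (label (e (i - 1))).
Proof.
move=> eE; have h := delta_label (e (i - 2)); have h' := delta_label (e (i - 1)).
move: h h'; rewrite !eE subrK.
have -> : i - 2 + 1 = i - 1 by ring.
exact: stP.
Qed.

(** Reading labels is a one-block code. Its inverse has memory 2: the two previous letters give the
    source of an edge, the current one its label. *)
Lemma conjugate_graph_shift : conjugate X (edge_shift graph_matrix).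
Proof.
pose Y := edge_shift graph_matrix.
pose lift (x : int -> A) (e : int -> edge graph_matrix) :=
  forall i, source (e i) = st (x (i - 2)) (x (i - 1)) /\ label (e i) = x i.
have exF (x : X) : exists y : Y, lift (val x) (val y).
  case: x => x Xx /=; have /XP xP := set_mem Xx.
  have /choice[e eP] : forall i, exists e : edge graph_matrix,
      source e = st (x (i - 2)) (x (i - 1)) /\ label e = x i.
    move=> i; have := xP (i - 2); rewrite subrK.
    have -> : i - 2 + 1 = i - 1 by ring.
    by move=> /edge_ex[e se le]; exists e.
  suff Ye : Y e by exists (SigSub (mem_set Ye)).
  (* The target of [e i] is computed by [delta], and [XP] at [i - 2] identifies it with the source
     of [e (i + 1)]. *)
  move=> i; apply: Some_inj; rewrite -delta_label !(eP _).1 (eP _).2.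
  have := xP (i - 2); rewrite subrK.
  have -> : i - 2 + 1 = i - 1 by ring.
  have -> : i + 1 - 2 = i - 1 by ring.
  by rewrite addrK => ->.
have exG (y : Y) : exists x : X, forall i, val x i = label (val y i).
  case: y => y Yy /=; have {}Yy := set_mem Yy.
  suff Xx : X (fun i => label (y i)) by exists (SigSub (mem_set Xx)).
  apply/XP => i.
  (* The two states are the sources of the edges at [i + 2] and [i + 3], that is, the two ends of
     the edge at [i + 2]. *)
  rewrite (_ : i + 1 = i + 2 - 1); last by ring.
  rewrite -[in st (label (y i))](addrK 2 i) -source_st //.
  rewrite -[in label (y (i + 2))](addrK 1 (i + 2)).
  rewrite (_ : i + 2 - 1 = i + 2 + 1 - 2); last by ring.
  by rewrite -source_st // addrK -Yy; apply: delta_label.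
have [f fP] := choice exF; have [g gP] := choice exG.
exists f, g; split.
- apply: (@sliding_block_code_of_window _ _ _ _ f 2 0 (fun w e =>
    if w is [:: u; v; t] then (source e == st u v) && (label e == t) else false)).
    move=> [|u [|v [|t [|]]]] //= e e' /andP[/eqP s /eqP l] /andP[/eqP s' /eqP l'].
    by apply: edge_inj; congruence.
  move=> x i; have [/eqP + /eqP] := fP x i; rewrite /= addr0 subrK.
  have -> : i - 2 + 1 = i - 1 by ring.
  by move=> -> ->.
- apply: (@sliding_block_code_of_window _ _ _ _ g 0 0 (fun w a =>
    if w is [:: e] then a == label e else false)).
    by move=> [|e []] //= a a' /eqP-> /eqP->.
  by move=> y i /=; rewrite subr0 addr0 gP.
- move=> x; apply: val_inj; apply/funext => i.
  by rewrite gP (fP x i).2.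
- move=> y; apply: val_inj; apply/funext => i.
  have [s l] := fP (g y) i; apply: edge_inj; last by rewrite l gP.
  by rewrite s !gP -source_st //; apply: set_mem (valP y).
Qed.

End LabelledGraph.

(** * The renewal system and its local description *)

Section Letters.
Variables c d : nat.

Definition letter : finType := ('I_3 + 'I_2 + ('I_c + 'I_d))%type.

Definition isA (x : letter) := if x is inl (inl _) then true else false.
Definition isB (x : letter) := if x is inl (inr _) then true else false.
Definition isC (x : letter) := if x is inr (inl _) then true else false.

Definition words : seq (seq letter) :=
  [seq [:: x] | x in [pred x | ~~ isC x]] ++
  [seq [:: p.1; p.2] | p in
    [pred p : letter * letter | isA p.1 && isC p.2 || isC p.1 && isB p.2]].

Lemma mem_words1 x : ~~ isC x -> [:: x] \in words.
Proof. by move=> Cx; rewrite mem_cat (fintype.image_f (fun x => [:: x])). Qed.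

Lemma mem_words2 x y : isA x && isC y || isC x && isB y -> [:: x; y] \in words.
Proof.
move=> xy; rewrite mem_cat; apply/orP; right.
exact: (fintype.image_f (fun p : letter * letter => [:: p.1; p.2]) (x := (x, y))).
Qed.

Lemma wordsP (Q : seq letter -> Prop) :
  (forall x, ~~ isC x -> Q [:: x]) ->
  (forall x y, isA x && isC y || isC x && isB y -> Q [:: x; y]) ->
  forall w, w \in words -> Q w.
Proof.
move=> Q1 Q2 w; rewrite mem_cat => /orP[] /fintype.imageP[x + ->]; rewrite inE.
  exact: Q1.
exact: Q2.
Qed.

Definition ok x y z := isC y ==> isA x || isB z.

Definition local_shift : set (int -> letter) :=
  [set x | forall i : int, ok (x i) (x (i + 1)) (x (i + 2))]%classic.

(* [p] tells whether the letter preceding [w] may serve as the partner of the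
   first letter of [w]; no partner is available after the end of [w]. *)
Fixpoint safe (p : bool) (w : seq letter) : bool :=
  if w is y :: w' then
    (isC y ==> p || (if w' is z :: _ then isB z else false)) && safe (isA y) w'
  else true.

(** Each C has its partner inside its own word, so the flag [p] is arbitrary. *)
Lemma safe_flatten p s : {subset s <= words} -> safe p (flatten s).
Proof.
elim: s p => //= w s IH p sL; have {}IH q : safe q (flatten s).
  by apply: IH => v vs; apply: sL; rewrite inE vs orbT.
move: {sL} (sL w (mem_head _ _)); move: w; apply: wordsP => [x /negPf Cx | x y].
  by rewrite /= Cx IH.
by move: x y => [[x|x]|[x|x]] [[y|y]|[y|y]] //= _; rewrite ?orbT IH.
Qed.

Lemma safe_infix p x y z w : safe p w -> infix [:: x; y; z] w -> ok x y z.
Proof.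
move=> + /infixP[u [v wE]]; rewrite {w}wE; elim: u p => [|t u IH] p /=.
  by case/and3P.
by move=> /andP[_ /IH].
Qed.

(** Greedy parsing from the left: a C goes with the A before it if there is one, otherwise with the
    B after it. *)
Lemma safe_parse w : safe false w ->
  exists2 s, {subset s <= words} & w = flatten s.
Proof.
have [n] := ubnP (size w); elim: n w => // n IH [|x [|y w]] /=.
- by exists [::].
- rewrite andbT implybF => _ Cx; exists [:: [:: x]] => // v.
  by rewrite inE => /eqP->; apply: mem_words1.
rewrite !ltnS => wn /and3P[Cx Cy sw].
have [xy|xy] := boolP (isA x && isC y || isC x && isB y).
  have [||s sL ->] := IH w; [exact: ltnW | | exists ([:: x; y] :: s)] => //.
    (* The second letter of a two-letter word is a C or a B, so the flag for the rest is false. *)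
    by move: xy sw {wn Cx Cy}; case: x y => [[x|x]|[x|x]] [[y|y]|[y|y]].
  by move=> v; rewrite inE => /predU1P[->|/sL//]; apply: mem_words2.
have [||s sL ->] := IH (y :: w) => //=.
  (* As AC is excluded here, a C in position [y] must rely on the letter after it, so cutting before
     [y] is harmless. *)
  rewrite sw andbT; move: xy Cy {wn Cx sw}.
  by case: x y => [[x|x]|[x|x]] [[y|y]|[y|y]].
exists ([:: x] :: s) => // v; rewrite inE => /predU1P[->|/sL//].
apply: mem_words1; move: xy Cx {Cy sw wn}.
by case: x y => [[x|x]|[x|x]] [[y|y]|[y|y]].
Qed.

(** The appended B serves a C at the right end of the block; [p] does the same for an A just before
    the block. *)
Lemma safe_block (x : int -> letter) (b : letter) i n (p : bool) :
  local_shift x -> isB b -> (isA (x i) -> p) ->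
  safe p (rcons (block x (i + 1) n) b).
Proof.
move=> Xx Bb; elim: n i p => [|n IH] i p xp.
  by case: b Bb => [[b|b]|[b|b]].
rewrite blockS /= IH // andbT; apply/implyP => Cx; have := Xx i.
rewrite /ok Cx /= => /orP[/xp -> //|Bx]; apply/orP; right.
by case: n {IH} => [|n] //; rewrite blockS /= -addrA.
Qed.

Lemma renewal_words : renewal_shift words = local_shift.
Proof.
apply/seteqP; split=> x Xx.
  move=> i; have [s sL] := Xx i 3; rewrite block3.
  exact: safe_infix (safe_flatten false sL).
move=> i n; have Bb : isB (inl (inr ord0) : letter) by [].
(* The block is framed by an A and a B, which can serve a C at either end; the framed word can be
   parsed. *)
have := safe_block (i := i - 1) n (p := true) Xx Bb (fun=> isT); rewrite subrK => sw.
have [//|s sL sE] :=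
  @safe_parse (inl (inl ord0) :: rcons (block x i n) (inl (inr ord0))).
exists s => //; rewrite -sE -cats1 -cat1s; apply/infixP.
by exists [:: inl (inl ord0)], [:: inl (inr ord0)].
Qed.

Lemma finite_type_words : finite_type (renewal_shift words).
Proof.
rewrite renewal_words.
exists [seq [:: p.1.1; p.1.2; p.2] | p in
  [pred p : letter * letter * letter | ~~ ok p.1.1 p.1.2 p.2]].
apply/seteqP; split=> x Xx.
  move=> w /fintype.imageP[[[u v] t] /= bad ->] [i]; rewrite block3 => -[ui vi ti].
  by move: bad; rewrite inE /= -ui -vi -ti Xx.
move=> i; apply/negPn/negP => bad; apply: (Xx [:: x i; x (i + 1); x (i + 2)]).
  exact: (fintype.image_f
    (fun p : letter * letter * letter => [:: p.1.1; p.1.2; p.2])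
    (x := (x i, x (i + 1), x (i + 2)))).
by exists i; exact: block3.
Qed.

(* State 0: the last letter is an A; state 2: the last letter is a C that still
   needs a B on its right; state 1: anything else. *)
Definition delta (i : 'I_3) (x : letter) : option 'I_3 :=
  if i == 2 then (if isB x then Some 1 else None)
  else if isA x then Some 0
  else if isC x && (i != 0) then Some 2 else Some 1.

Definition st (x y : letter) : 'I_3 :=
  if isA y then 0 else if isC y && ~~ isA x then 2 else 1.

Lemma delta_st x y z : delta (st x y) z = Some (st y z) <-> ok x y z.
Proof.
by case: x => [[x|x]|[x|x]]; case: y => [[y|y]|[y|y]]; case: z => [[z|z]|[z|z]].
Qed.

(** State 0 is entered exactly by reading an A, so [j] remembers all that [st] needs of [x]. *)
Lemma st_delta i x j y k : delta i x = Some j -> delta j y = Some k -> k = st x y.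
Proof.
by rewrite /delta /st; case: i => [[|[|[]]] // ?];
  case: x => [[x|x]|[x|x]] //= [<-]; case: y => [[y|y]|[y|y]] //= [<-].
Qed.

Lemma conjugate_words :
  conjugate (renewal_shift words) (edge_shift (graph_matrix delta)).
Proof.
rewrite renewal_words.
apply: (@conjugate_graph_shift _ _ _ st); last exact: st_delta.
by move=> x; split=> Xx i; apply/delta_st; apply: Xx.
Qed.

(** * Determinant and Bowen-Franks group *)

Lemma card_letter (P : pred letter) (a b e f : bool) :
  (forall i, P (inl (inl i)) = a) -> (forall i, P (inl (inr i)) = b) ->
  (forall i, P (inr (inl i)) = e) -> (forall i, P (inr (inr i)) = f) ->
  #|[pred x | P x]| = (a * 3 + b * 2 + (e * c + f * d))%N.
Proof.
move=> Pa Pb Pe Pf; rewrite -sum1_card big_mkcond !big_sumType /=.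
by congr (_ + _ + (_ + _))%N; (under eq_bigr do rewrite inE ?Pa ?Pb ?Pe ?Pf);
  rewrite sum_nat_const card_ord; case: (X in if X then _ else _) => //=; lia.
Qed.

Lemma id_minus_wordsE : id_minus (graph_matrix delta) =
  \matrix_(i < 3, j < 3) nth 0 (nth [::]
    [:: [:: - 2%:Z; - (2 + c%:Z + d%:Z); 0];
        [:: - 3%:Z; - (1 + d%:Z); - c%:Z];
        [:: 0; - 2%:Z; 1]] i) j.
Proof.
apply/matrixP => i j; rewrite !mxE.
case: i => [[|[|[|//]]] ilt]; case: j => [[|[|[|//]]] jlt] /=.
- by rewrite (card_letter (a := true) (b := false) (e := false) (f := false)) //; lia.
- by rewrite (card_letter (a := false) (b := true) (e := true) (f := true)) //; lia.
- by rewrite (card_letter (a := false) (b := false) (e := false) (f := false)) //; lia.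
- by rewrite (card_letter (a := true) (b := false) (e := false) (f := false)) //; lia.
- by rewrite (card_letter (a := false) (b := true) (e := false) (f := true)) //; lia.
- by rewrite (card_letter (a := false) (b := false) (e := true) (f := false)) //; lia.
- by rewrite (card_letter (a := false) (b := false) (e := false) (f := false)) //; lia.
- by rewrite (card_letter (a := false) (b := true) (e := false) (f := false)) //; lia.
- by rewrite (card_letter (a := false) (b := false) (e := false) (f := false)) //; lia.
Qed.

Lemma det_words : \det (id_minus (graph_matrix delta)) = c%:Z - d%:Z - 4.
Proof.
rewrite id_minus_wordsE.
do 2!rewrite !(expand_det_row _ 0) !big_ord_recl !big_ord0 /cofactor.
rewrite !det_mx11 !mxE /=.
rewrite /bump /=; ring.
Qed.

(* Modulo the rows, e_0 = (1 - c) e_1 and e_2 = 2 e_1. *)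
Lemma cyclic_words : cyclic_zmod (bowen_franks (graph_matrix delta)).
Proof.
pose e1 : 'rV[int]_3 := delta_mx 0 1.
exists (\pi_(bowen_franks (graph_matrix delta)) e1)%qT => x.
rewrite -[x]reprK; set v := repr x.
exists (v 0 0 * (1 - c%:Z) + v 0 1 + 2 * v 0 2).
rewrite -raddfMz; apply/eqP; rewrite -Quotient.idealrBE.
(* Row 0 minus row 1 minus [c] times row 2 is e_0 - (1 - c) e_1, and row 2 is e_2 - 2 e_1; these are
   taken [v 0 0] and [v 0 2] times. *)
apply/asboolP; exists (\row_j nth 0 [:: v 0 0; - v 0 0; v 0 2 - c%:Z * v 0 0] j).
apply/matrixP => i j; rewrite -scaler_int intz id_minus_wordsE !mxE !big_ord_recl big_ord0 !mxE /=.
rewrite ord1; case: j => [[|[|[|//]]] jlt] /=.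
- by have -> : Ordinal jlt = 0 by [exact: val_inj]; ring.
- by have -> : Ordinal jlt = 1 by [exact: val_inj]; ring.
- by have -> : Ordinal jlt = 2 by [exact: val_inj]; ring.
Qed.

End Letters.

Theorem theorem5p51 (k : int) :
  exists (A : finType) (L : seq (seq A)),
    [/\ L != [::], [::] \notin L, finite_type (renewal_shift L)
      & exists (n : nat) (M : 'M[nat]_n),
          [/\ conjugate (renewal_shift L) (edge_shift M),
              \det (id_minus M) = k
            & cyclic_zmod (bowen_franks M)]].
Proof.
have [c [d kE]] : exists c d : nat, k = c%:Z - d%:Z - 4.
  (* For nonnegative [k], [c] absorbs the 4; for negative [k], [c = 4] cancels it and [d] is the
     absolute value. *)
  by case: k => n; [exists (n + 4)%N, 0%N | exists 4%N, n.+1]; lia.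
exists (letter c d), (words c d); split.
- have : [:: inl (inl ord0)] \in words c d by apply: mem_words1.
  by case: (words c d).
- apply/negP; set P := [::].
  by move=> /(wordsP (Q := fun w => w != P) (fun _ _ => isT) (fun _ _ _ => isT)).
- exact: finite_type_words.
- exists 3, (graph_matrix (@delta c d)); split; first exact: conjugate_words.
    by rewrite det_words -kE.
  exact: cyclic_words.
Qed.
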